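(* Let $r$ be continuous, let $f$ be a nontrivial real solution of $f''(x)+r(x)f(x)=0$, let $z_{f'_1}<z_{f'_2}$ be two consecutive zeros of $f'$, let $\mathcal{I}=(z_{f'_1},z_{f'_2})$, and let $z_{f_1}$ be the unique zero of $f$ in $\mathcal{I}$. Put $h=f/f'$ on $\mathcal I$. Suppose $r(x)>0$ for all $x\in\mathcal{I}$. For an initial guess $x_0\in\mathcal I$ consider Halley's iteration $$x_{n+1}=x_n-\frac{2h(x_n)}{2+r(x_n)h^2(x_n)},\qquad n=0,1,2,\dots$$ (1) If $r$ is non-increasing in $(z_{f'_1},z_{f_1})$, then for every initial guess $x_0\in(z_{f'_1},z_{f_1})$ the sequence $(x_n)$ is well defined and converges monotonically to $z_{f_1}$. (2) If $r$ is non-decreasing in $(z_{f_1},z_{f'_2})$, then for every initial guess $x_0\in(z_{f_1},z_{f'_2})$ the sequence $(x_n)$ is well defined and converges monotonically to $z_{f_1}$.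
   Context: All functions are real-valued; $r$ is continuous on an open interval $D\subseteq\mathbb{R}$ containing all points mentioned, and $f$ is a not identically zero solution on $D$ of $f''+rf=0$. It is a standing assumption that $f$ has exactly one zero $z_{f_1}$ in $\mathcal I=(z_{f'_1},z_{f'_2})$. Since $f'$ has no zeros in $\mathcal I$, the function $h=f/f'$ is defined on $\mathcal I$. ''Converges monotonically'' means that the sequence is monotone and converges. *)

(* Defs.v *)
From mathcomp Require Import all_boot all_order all_algebra.
From mathcomp Require Import all_classical all_reals all_analysis.
Import Order.TTheory GRing.Theory Num.Theory.
Import numFieldNormedType.Exports.

Set Implicit Arguments.
Unset Strict Implicit.
Unset Printing Implicit Defensive.

Local Open Scope classical_set_scope.
Local Open Scope ring_scope.

Section Halley.
Context {R : realType}.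
Implicit Types (r f : R -> R) (D : set R) (a b x z : R).

(* [f^`()] is a total function; on an open [D], its values there depend only
   on the values of [f] on [D]. *)
Definition ode_solution D r f : Prop :=
  forall x, D x ->
    [/\ derivable f x 1, derivable f^`()%classic x 1 &
        f^`(2)%classic x + r x * f x = 0].

Definition nontrivial_on D f : Prop := exists2 x, D x & f x != 0.

Definition consecutive_zeros (g : R -> R) a b : Prop :=
  [/\ a < b, g a = 0, g b = 0 & {in `]a, b[, forall x, g x != 0}].

Definition unique_zero_in (A : interval R) f z : Prop :=
  [/\ z \in A, f z = 0 & {in A, forall y, f y = 0 -> y = z}].

Definition newton_ratio f x : R := f x / f^`()%classic x.

Definition halley_denom r f x : R := 2 + r x * newton_ratio f x ^+ 2.

Definition halley_step r f x : R :=
  x - (2 * newton_ratio f x) / halley_denom r f x.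

Definition halley_seq r f x0 : R^nat := fun n => iter n (halley_step r f) x0.

(* Division is total here, so well-definedness is stated separately: every
   iterate stays in [A], the domain of [f / f'], and no division by zero
   occurs. *)
Definition halley_well_defined (A : interval R) r f x0 : Prop :=
  forall n, [/\ halley_seq r f x0 n \in A,
                f^`()%classic (halley_seq r f x0 n) != 0 &
                halley_denom r f (halley_seq r f x0 n) != 0].

Definition cvg_monotonically (u : R^nat) z : Prop :=
  (nondecreasing_seq u \/ nonincreasing_seq u) /\ u @ \oo --> z.

End Halley.

(* Main.v *)
Require Import Defs.
From mathcomp Require Import all_boot all_order all_algebra.
From mathcomp Require Import all_classical all_reals all_analysis.
From mathcomp Require Import ring lra.
Import Order.TTheory GRing.Theory Num.Theory.
Import numFieldNormedType.Exports.

Local Open Scope classical_set_scope.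
Local Open Scope ring_scope.

(** The ratio [h = f / f'] satisfies the Riccati equation [h' = 1 + r h^2].
    For a constant [c >= r >= 0] the map [t |-> t - 2 h / (2 + c h^2)] has
    derivative [1 - phi'(h) h'], where [phi y = 2 y / (2 + c y^2)], and this is
    nonnegative: either [phi'(h) <= 0], or
    [phi'(h) h' <= phi'(h) (1 + c h^2) <= 1].  Taking [c = r x], the monotonicity
    of [r] gives [r <= c] between [x] and [z], so the Halley step from [x], being
    the value of this map at [x], does not jump over its value [z] at [z].
    The iterates therefore move monotonically towards [z], and their limit is a
    fixed point of the step, that is, a zero of [f]. *)

Lemma ge0_is_derive_le (R : realType) (g dg : R -> R) (a b : R) :
  a <= b ->
  {in `[a, b], forall x : R, is_derive x 1 g (dg x)} ->
  {in `]a, b[, forall x, 0 <= dg x} ->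
  g a <= g b.
Proof.
move=> leab gE dg_ge0.
have sub x : x \in `]a, b[ -> x \in `[a, b] by apply: subset_itv_oo_cc.
apply: (@ger0_derive1_le _ g a b _ _ true false); rewrite ?in_itv/= ?lexx ?leab//.
- by move=> x /sub /gE [].
- by move=> x xab; have [_] := gE x (sub _ xab); rewrite -derive1E => ->; exact: dg_ge0.
- by apply: derivable_within_continuous => x /gE [].
Qed.

(** A monotone sequence confined to [[a, b]] converges, and closedness keeps its limit in [[a, b]].
    Passing to the limit in [u n.+1 = S (u n)], continuity makes the limit a fixed point of [S],
    hence equal to [z]. *)
Lemma iter_monotone_cvg (R : realType) (S : R -> R) (a b z x0 : R) :
  {in `[a, b], forall x, S x \in `[a, b]} ->
  {in `[a, b], forall x, {for x, continuous S}} ->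
  {in `[a, b], forall x, S x = x -> x = z} ->
  {in `[a, b], forall x, x <= S x} \/ {in `[a, b], forall x, S x <= x} ->
  x0 \in `[a, b] ->
  (forall n, iter n S x0 \in `[a, b]) /\
  cvg_monotonically (fun n => iter n S x0) z.
Proof.
move=> Sab Sc Sfix Smono x0ab.
set u := fun n => iter n S x0.
have uab n : u n \in `[a, b] by elim: n => [//|n IHn]; exact: Sab.
split; first exact: uab.
have umono : nondecreasing_seq u \/ nonincreasing_seq u.
  by case: Smono => le_S; [left; apply/nondecreasing_seqP|
    right; apply/nonincreasing_seqP] => n; exact: le_S.
split=> //.
have cu : cvgn u.
  case: umono => [/nondecreasing_is_cvgn|/nonincreasing_is_cvgn]; apply.
    by exists b => _ [n _ <-]; rewrite (itvP (uab n)).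
  by exists a => _ [n _ <-]; rewrite (itvP (uab n)).
have lab : limn u \in `[a, b].
  rewrite in_itv/=; apply/andP; split.
    by apply: limr_ge => //; apply: nearW => n; rewrite (itvP (uab n)).
  by apply: limr_le => //; apply: nearW => n; rewrite (itvP (uab n)).
suff <- : limn u = z by [].
apply: Sfix => //; apply: (@cvg_unique _ _ (u n.+1 @[n --> \oo])) => //=.
  by apply: (@continuous_cvg _ _ _ _ _ u S) => //; exact: Sc.
by rewrite (cvg_shiftS u).
Qed.

Lemma riccati_halley_map_le (R : realType) (h r : R -> R) (a b c : R) :
  a <= b -> 0 <= c ->
  {in `[a, b], forall x : R, is_derive x 1 h (1 + r x * h x ^+ 2)} ->
  {in `]a, b[, forall x, 0 <= r x <= c} ->
  a - 2 * h a / (2 + c * h a ^+ 2) <= b - 2 * h b / (2 + c * h b ^+ 2).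
Proof.
move=> leab c0 hE rc.
have den_gt0 y : 0 < 2 + c * y ^+ 2 by rewrite ltr_pwDl// mulr_ge0// sqr_ge0.
(* The fraction in the derivative is [phi' y = (4 - 2 c y^2) / (2 + c y^2)^2] at [y = h t]; the last
   factor is [h']. *)
apply: (@ge0_is_derive_le _ (fun t => t - 2 * h t / (2 + c * h t ^+ 2))
  (fun t => 1 - (4 - 2 * c * h t ^+ 2) / (2 + c * h t ^+ 2) ^+ 2 *
    (1 + r t * h t ^+ 2))) => // x xab.
  have hx := hE x xab.
  have dx : is_derive x 1 (fun t => 2 + c * h t ^+ 2)
     (2 * c * h x * (1 + r x * h x ^+ 2)).
    by apply: is_derive_eq; rewrite /GRing.scale/=; ring.
  have := @is_deriveV _ (fun t => 2 + c * h t ^+ 2) _ _ _ (lt0r_neq0 (den_gt0 (h x))) dx => ?.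
  apply: is_derive_eq; rewrite /GRing.scale/=.
  by field; rewrite lt0r_neq0.
have /andP[r0 rcx] := rc x xab.
have d0 := den_gt0 (h x).
have h0 : 0 <= h x ^+ 2 by exact: sqr_ge0.
rewrite subr_ge0 mulrAC ler_pdivrMr ?exprn_gt0// mul1r.
move: (h x ^+ 2) h0 {d0} => k k0.
have ck := mulr_ge0 c0 k0; have rk := mulr_ge0 r0 k0.
have rck : r x * k <= c * k by rewrite ler_wpM2r.
(* With [p = c h^2] and [q = r h^2], the goal is [(4 - 2 p) (1 + q) <= (2 + p)^2] for [0 <= q <= p].
   If [p <= 2], replacing [q] by [p] bounds the left side by [4 + 2 p - 2 p^2]; if [p > 2], the left
   side is negative. *)
move: (c * k) (r x * k) ck rk rck (mulrA 2 c k) => p q p0 q0 qp <-.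
have [?|?] := lerP p 2; nra.
Qed.

(** The quotient rule gives [h' = 1 - f f'' / f'^2], and the equation replaces [f''] by [- r f]. *)
Lemma newton_ratio_riccati (R : realType) (D : set R) (r f : R -> R) (x : R) :
  ode_solution D r f -> D x -> f^`()%classic x != 0 ->
  is_derive x 1 (newton_ratio f) (1 + r x * newton_ratio f x ^+ 2).
Proof.
move=> sol_f Dx f'x; have [df df' fE] := sol_f x Dx.
have fx : is_derive x 1 f (f^`()%classic x).
  by rewrite derive1E; exact: derivableP.
have f'xE : is_derive x 1 f^`()%classic (- (r x * f x)).
  rewrite -(addr0_eq fE) opprK.
  by rewrite derive1nS derive1n1 derive1E; exact: derivableP.
have := @is_deriveV _ f^`()%classic _ _ _ f'x f'xE => ?.
rewrite /newton_ratio.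
by apply: is_derive_eq; rewrite /GRing.scale/=; field.
Qed.

Theorem theorem3p6 (R : realType) (D : set R) (r f : R -> R) (z1 z2 z : R)
  (openD : open D) (intervalD : is_interval D) (Dz1 : D z1) (Dz2 : D z2)
  (cont_r : forall x, D x -> {for x, continuous r})
  (sol_f : ode_solution D r f)
  (f_neq0 : nontrivial_on D f)
  (z1z2 : consecutive_zeros f^`()%classic z1 z2)
  (zf : unique_zero_in `]z1, z2[ f z)
  (r_gt0 : {in `]z1, z2[, forall x, 0 < r x}) :
  ({in `]z1, z[ &, {homo r : x y /~ x <= y}} ->
   {in `]z1, z[, forall x0,
     halley_well_defined `]z1, z2[ r f x0 /\
     cvg_monotonically (halley_seq r f x0) z}) /\
  ({in `]z, z2[ &, {homo r : x y / x <= y}} ->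
   {in `]z, z2[, forall x0,
     halley_well_defined `]z1, z2[ r f x0 /\
     cvg_monotonically (halley_seq r f x0) z}).
Proof.
have [_ _ _ f'_neq0] := z1z2.
have [zI fz0 z_uniq] := zf.
have hE : {in `]z1, z2[, forall x : R,
    is_derive x 1 (newton_ratio f) (1 + r x * newton_ratio f x ^+ 2)}.
  move=> x xI; apply: (newton_ratio_riccati _ D) => //; last exact: f'_neq0.
  by apply: (intervalD z1 z2) => //; rewrite !ltW ?(itvP xI).
have hz0 : newton_ratio f z = 0 by rewrite /newton_ratio fz0 mul0r.
have den_gt0 : {in `]z1, z2[, forall x, 0 < halley_denom r f x}.
  by move=> x xI; rewrite ltr_pwDl// mulr_ge0 ?sqr_ge0// ltW// r_gt0.
(* Since [h' = 1 + r h^2 > 0] and [h z = 0], this fixes the sign of [h] on each side of [z], hence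
   the direction of the step. *)
have h_mono (a b : R) : (`[a, b] <= `]z1, z2[)%O -> a <= b ->
    newton_ratio f a <= newton_ratio f b.
  move=> /subitvP abI leab; apply: (ge0_is_derive_le _ _ (fun x => 1 + r x * newton_ratio f x ^+ 2)
    _ _ leab).
    by move=> x /abI /hE; exact.
  move=> x /subset_itv_oo_cc /abI xI.
  by rewrite addr_ge0// mulr_ge0 ?sqr_ge0// ltW// r_gt0.
(* The coefficient is frozen at [r c]; with [c = x] the map agrees with [halley_step r f] at the
   point [x]. *)
have map_mono (a b c : R) : (`[a, b] <= `]z1, z2[)%O -> a <= b -> c \in `]z1, z2[ ->
    {in `]a, b[, forall x, r x <= r c} ->
    a - 2 * newton_ratio f a / (2 + r c * newton_ratio f a ^+ 2) <=
    b - 2 * newton_ratio f b / (2 + r c * newton_ratio f b ^+ 2).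
  move=> /subitvP abI leab cI rc; apply: (riccati_halley_map_le _ _ r) => //.
  - by rewrite ltW// r_gt0.
  - by move=> x /abI /hE; exact.
  - by move=> x xab; rewrite rc// ltW// r_gt0//; exact/abI/subset_itv_oo_cc.
have stepc : {in `]z1, z2[, forall x, {for x, continuous (halley_step r f)}}.
  move=> x xI.
  have hc : {for x, continuous (newton_ratio f)}.
    by apply/differentiable_continuous/derivable1_diffP; case: (hE x xI).
  have rc : {for x, continuous r}.
    by apply/cont_r/(intervalD z1 z2) => //; rewrite !ltW ?(itvP xI).
  have d0 := lt0r_neq0 (den_gt0 x xI).
  apply: cvgB; first exact: cvg_id.
  apply: cvgM; first by apply: cvgM; [exact: cvg_cst|exact: hc].
  apply: cvgV => //; apply: cvgD; first exact: cvg_cst.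
  by apply: cvgM; [exact: rc|apply: cvgM; exact: hc].
have step_fix : {in `]z1, z2[, forall x, halley_step r f x = x -> x = z}.
  move=> x xI /eqP; rewrite /halley_step -subr_eq0 addrAC subrr add0r oppr_eq0.
  (* As inversion sends 0 to 0, a vanishing divisor would also give a fixed point. Excluding this
     for [halley_denom] and then for [f'] leaves [f x = 0]. *)
  rewrite mulf_eq0 invr_eq0 (negbTE (lt0r_neq0 (den_gt0 x xI))) orbF.
  rewrite mulf_eq0 pnatr_eq0/= mulf_eq0 invr_eq0 (negbTE (f'_neq0 x xI)) orbF.
  by move=> /eqP; exact: z_uniq.
have step_z c : z - 2 * newton_ratio f z / (2 + c * newton_ratio f z ^+ 2) = z.
  by rewrite hz0 mulr0 mul0r subr0.
have conclude (a b x0 : R) : (`[a, b] <= `]z1, z2[)%O -> x0 \in `[a, b] ->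
    {in `[a, b], forall x, halley_step r f x \in `[a, b]} ->
    {in `[a, b], forall x, x <= halley_step r f x} \/
    {in `[a, b], forall x, halley_step r f x <= x} ->
    halley_well_defined `]z1, z2[ r f x0 /\
    cvg_monotonically (halley_seq r f x0) z.
  move=> /subitvP abI x0ab Sab Smono.
  have [] := @iter_monotone_cvg _ _ a b z x0 Sab _ _ Smono x0ab.
  - by move=> x /abI; exact: stepc.
  - by move=> x /abI; exact: step_fix.
  move=> uab ucvg; split=> // n; have /abI uI := uab n.
  by split=> //; [exact: f'_neq0|rewrite lt0r_neq0// den_gt0].
have segI (a b : R) : z1 < a -> b < z2 -> (`[a, b] <= `]z1, z2[)%O.
  by move=> z1a bz2; rewrite subitvE !bnd_simp z1a.
split=> rmono x0 x0I.
- have up : {in `[x0, z], forall x, x <= halley_step r f x}.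
    move=> x xI; rewrite /halley_step lerBrDr gerDl.
    have xI' : x \in `]z1, z2[.
      by move: xI; apply/subitvP/segI; rewrite ?(itvP x0I) ?(itvP zI).
    rewrite pmulr_lle0 ?invr_gt0 ?den_gt0// pmulr_rle0// -hz0.
    by apply: h_mono; [apply: segI|]; rewrite ?(itvP xI) ?(itvP xI') ?(itvP zI).
  apply: (conclude x0 z) => //; last by left.
  + by apply: segI; rewrite ?(itvP x0I) ?(itvP zI).
  + by rewrite in_itv/= lexx ltW ?(itvP x0I).
  move=> x xI; rewrite in_itv/= (le_trans _ (up x xI)) ?(itvP xI)//=.
  have xI' : x \in `]z1, z2[.
    by move: xI; apply/subitvP/segI; rewrite ?(itvP x0I) ?(itvP zI).
  rewrite -[leRHS](step_z (r x)); apply: map_mono; rewrite ?(itvP xI)//.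
    by apply: segI; rewrite ?(itvP xI') ?(itvP zI).
  (* The existence of [t] strictly between [x] and [z] excludes [x = z], so [x] lies in the open
     interval where [r] is monotone. *)
  move=> t txz; apply: rmono; rewrite ?(itvP txz)// in_itv/= ?(itvP txz) ?andbT.
    by rewrite (@lt_trans _ _ x) ?(itvP txz) ?(itvP xI').
  by rewrite (itvP xI').
- have down : {in `[z, x0], forall x, halley_step r f x <= x}.
    move=> x xI; rewrite /halley_step lerBlDr lerDl.
    have xI' : x \in `]z1, z2[.
      by move: xI; apply/subitvP/segI; rewrite ?(itvP x0I) ?(itvP zI).
    rewrite pmulr_lge0 ?invr_gt0 ?den_gt0// pmulr_rge0// -hz0.
    by apply: h_mono; [apply: segI|]; rewrite ?(itvP xI) ?(itvP xI') ?(itvP zI).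
  apply: (conclude z x0) => //; last by right.
  + by apply: segI; rewrite ?(itvP x0I) ?(itvP zI).
  + by rewrite in_itv/= lexx andbT ltW ?(itvP x0I).
  move=> x xI; rewrite in_itv/= (le_trans (down x xI)) ?(itvP xI)//= andbT.
  have xI' : x \in `]z1, z2[.
    by move: xI; apply/subitvP/segI; rewrite ?(itvP x0I) ?(itvP zI).
  (* Here the coefficient is frozen at the right end of [[z, x]], where a non-decreasing [r] is
     largest. *)
  rewrite -[leLHS](step_z (r x)); apply: map_mono; rewrite ?(itvP xI)//.
    by apply: segI; rewrite ?(itvP xI') ?(itvP zI).
  move=> t txz; apply: rmono; rewrite ?(itvP txz)// in_itv/= ?(itvP txz).
    by rewrite (@lt_trans _ _ x) ?(itvP txz) ?(itvP xI').
  by rewrite (itvP xI').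
Qed.
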